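(* Every finite poset $\mathbf{P}=(X,\leq)$ is an ellipsoid order; that is, there exist an integer $k\ge 1$ and an assignment $x\mapsto F(x)$ of an ellipsoid $F(x)\subseteq\mathbb{R}^k$ to each $x\in X$ such that for all $x,y\in X$: $x\leq y$ if and only if $F(x)\subseteq F(y)$.
   Context: A poset is a set with a reflexive, antisymmetric and transitive relation. An ellipsoid in $\mathbb{R}^k$ means a solid (closed, full-dimensional) ellipsoid, i.e. the image of the closed unit ball of $\mathbb{R}^k$ under an invertible affine map. *)

(* Defs.v *)
From mathcomp Require Import all_boot all_order all_algebra.
From mathcomp Require Import all_classical all_reals.
Set Implicit Arguments.
Unset Strict Implicit.
Unset Printing Implicit Defensive.
Import Order.TTheory GRing.Theory Num.Theory.
Local Open Scope classical_set_scope.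
Local Open Scope ring_scope.

(* The canonical norm that MathComp-Analysis puts on matrices is the sup norm,
   so the Euclidean norm has to be written out. *)
Definition euclidean_norm (R : realType) (k : nat) (u : 'cV[R]_k) : R :=
  Num.sqrt (\sum_(i < k) u i 0 ^+ 2).

Definition closed_unit_ball (R : realType) (k : nat) : set 'cV[R]_k :=
  [set u | euclidean_norm u <= 1].
Arguments closed_unit_ball : clear implicits.

Definition ellipsoid (R : realType) (k : nat) (E : set 'cV[R]_k) : Prop :=
  exists (A : 'M[R]_k) (b : 'cV[R]_k),
    A \in unitmx /\ E = (fun u => A *m u + b) @` closed_unit_ball R k.

Definition ellipsoid_order (R : realType) (d : Order.disp_t)
    (X : porderType d) : Prop :=
  exists k : nat, (1 <= k)%N /\
    exists F : X -> set 'cV[R]_k,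
      (forall x, ellipsoid (F x)) /\
      (forall x y : X, (x <= y)%O <-> F x `<=` F y).

(* Main.v *)
Require Import Defs.
From mathcomp Require Import all_boot all_order all_algebra.
From mathcomp Require Import all_classical all_reals.
Import Order.TTheory GRing.Theory Num.Theory.
Local Open Scope classical_set_scope.
Local Open Scope ring_scope.

(** Inclusion of origin-centred axis-parallel ellipsoids is the componentwise
    order on the vectors of semi-axes.  A finite poset [X] embeds into a
    componentwise order by sending [x] to the indicator of its down-set, so it
    suffices to take the semi-axis of [x] in direction [z] to be 2 if [z <= x]
    and 1 otherwise. *)

Lemma closed_unit_ballE (R : realType) (k : nat) (u : 'cV[R]_k) :
  closed_unit_ball R k u = (\sum_(i < k) u i 0 ^+ 2 <= 1) :> Prop.
Proof.
by rewrite /closed_unit_ball /euclidean_norm /= -[X in _ <= X]sqrtr1 ler_sqrt.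
Qed.

(** The summand [+ 0] keeps the literal shape required by [ellipsoid], with centre 0. *)
Definition axis_ellipsoid (R : realType) (k : nat) (r : 'rV[R]_k) :
    set 'cV[R]_k :=
  (fun u => diag_mx r *m u + 0) @` closed_unit_ball R k.

Lemma axis_ellipsoidP (R : realType) (k : nat) (r : 'rV[R]_k) :
  (forall i, 0 < r 0 i) -> ellipsoid (axis_ellipsoid R k r).
Proof.
move=> r_gt0; exists (diag_mx r), 0; split=> //.
by rewrite unitmxE det_diag unitfE prodf_seq_neq0; apply/allP => i _; rewrite gt_eqF.
Qed.

Lemma axis_ellipsoid_subset (R : realType) (k : nat) (r s : 'rV[R]_k) :
  (forall i, 0 < r 0 i) -> (forall i, 0 < s 0 i) ->
  axis_ellipsoid R k r `<=` axis_ellipsoid R k s <->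
  forall i, r 0 i <= s 0 i.
Proof.
move=> r_gt0 s_gt0; split=> [rs i | le_rs _ [u + <-]].
(* Test the inclusion on the tip of the [i]-th semi-axis, the image of the basis vector: it gives
   [r_i = s_i * v_i] for some [v] in the unit ball, and [v_i <= 1]. *)
- have ball_e : closed_unit_ball R k (delta_mx i 0).
    rewrite closed_unit_ballE (bigD1 i) //= big1 => [|j ji].
      by rewrite mxE !eqxx expr1n addr0.
    by rewrite mxE (negPf ji) expr0n.
  have [v + /matrixP/(_ i 0)] := rs _ (ex_intro2 _ _ _ ball_e erefl).
  rewrite closed_unit_ballE => ball_v.
  rewrite !addr0 !mul_diag_mx !mxE !eqxx mulr1 => <-.
  rewrite ger_pMr //; apply: le_trans (ler_norm _) _.
  rewrite -(@expr_le1 _ 2) // real_normK ?num_real //.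
  apply: le_trans ball_v.
  by rewrite (bigD1 i) //= lerDl sumr_ge0 // => j _; rewrite sqr_ge0.
- rewrite closed_unit_ballE => ball_u.
  (* The only possible preimage under [diag_mx s]; it stays in the ball since each factor
     [r_i / s_i] lies in [0, 1]. *)
  exists (\col_i (r 0 i / s 0 i * u i 0)); last first.
    rewrite !addr0; apply/matrixP => i j; rewrite (ord1 j) !mul_diag_mx !mxE.
    by rewrite mulrA [s 0 i * _]mulrC divfK // gt_eqF.
  rewrite closed_unit_ballE; apply: le_trans ball_u; apply: ler_sum => i _.
  rewrite mxE exprMn ler_piMl ?sqr_ge0 // expr_le1 //.
    by rewrite ler_pdivrMr // mul1r.
  by rewrite divr_ge0 // ltW.
Qed.

Theorem theorem4p2 (R : realType) (d : Order.disp_t) (X : finPOrderType d) :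
  ellipsoid_order R X.
Proof.
(* Indexing by [option X] adds a dummy axis, so that k >= 1 when X is empty. *)
pose below (x : X) (o : option X) := if o is Some z then (z <= x)%O else false.
pose r x : 'rV[R]_#|{: option X}| := \row_i (1 + (below x (enum_val i))%:R).
have r_gt0 x i : 0 < r x 0 i by rewrite mxE ltr_pwDl.
exists #|{: option X}|; split; first by rewrite card_option.
exists (fun x => axis_ellipsoid _ _ (r x)); split=> [x|x y].
  exact: axis_ellipsoidP.
rewrite axis_ellipsoid_subset //; split=> [xy i|/(_ (enum_rank (Some x)))].
  rewrite !mxE lerD2l ler_nat; case: (enum_val i) => //= z.
  by case: (boolP (z <= x)%O) => // /le_trans->.
(* On axis [Some x], reflexivity makes the semi-axis of [x] equal to 2, so that of [y] must be 2 as
   well, which means [x <= y]. *)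
by rewrite !mxE enum_rankK /= lexx lerD2l ler_nat; case: (x <= y)%O.
Qed.
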